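(* Let $\mathcal G$ be a metric star graph with edges $I_1,\dots,I_N$ and weights $\alpha_1,\dots,\alpha_N>0$, $\sum_{i=1}^N\alpha_i=1$. Any bounded harmonic function $w$ on $\mathcal G$ is constant.
   Context: A metric star graph $\mathcal G$ consists of a vertex $O$ to which $N$ half-line edges are attached; the $i$-th edge is identified with $I_i=[0,\infty)$, with $0$ corresponding to $O$. A function $w$ on $\mathcal G$ is a collection of functions $w_j:I_j\to\mathbb R$, $j=1,\dots,N$. Weights $\alpha_i>0$ with $\sum_{i=1}^N\alpha_i=1$ are fixed. A function $w$ (twice differentiable along each edge, with one-sided derivatives at $0$) is called harmonic on $\mathcal G$ if $$\partial_{xx}w_i=0\ \text{ on } I_i,\ i\in\{1,\dots,N\};\qquad w_i(0)=w_j(0),\ i,j\in\{1,\dots,N\};\qquad \sum_{j=1}^N\alpha_j\,\partial_xw_j(0)=0.$$ *)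

(* Defs.v *)
From HB Require Import structures.
From mathcomp Require Import all_boot all_order all_algebra.
From mathcomp Require Import all_classical all_reals all_analysis.

Set Implicit Arguments.
Unset Strict Implicit.
Unset Printing Implicit Defensive.

Import Order.TTheory GRing.Theory Num.Theory.
Import numFieldNormedType.Exports.

Local Open Scope classical_set_scope.
Local Open Scope ring_scope.

(* A function on the star graph with N edges is a family w : 'I_N -> R -> R
   of which only the values w i x with 0 <= x are meaningful: everything below
   depends on w i only through its restriction to [0, +oo[. *)

Section StarGraph.
Context {R : realType}.

(* The limit is taken along the points y != x of [0, +oo[: this is the usual
   (two-sided) derivative at x > 0 and the one-sided derivative at x = 0. *)
Definition edge_quotient (f : R -> R) (x y : R) : R := (f y - f x) / (y - x).

Definition edge_derivable (f : R -> R) (x : R) : Prop :=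
  cvg (edge_quotient f x y @[y --> within `[0, +oo[ x^']).

Definition edge_derive (f : R -> R) (x : R) : R :=
  lim (edge_quotient f x y @[y --> within `[0, +oo[ x^']).

Definition edge_twice_derivable (f : R -> R) : Prop :=
  forall x, 0 <= x -> edge_derivable f x /\ edge_derivable (edge_derive f) x.

Definition harmonic_on_graph (N : nat) (alpha : 'I_N -> R) (w : 'I_N -> R -> R) : Prop :=
  [/\ forall i, edge_twice_derivable (w i),
      forall i x, 0 <= x -> edge_derive (edge_derive (w i)) x = 0,
      forall i j, w i 0 = w j 0
    & \sum_(j < N) alpha j * edge_derive (w j) 0 = 0].

Definition bounded_on_graph (N : nat) (w : 'I_N -> R -> R) : Prop :=
  exists M : R, forall i x, 0 <= x -> `|w i x| <= M.

Definition constant_on_graph (N : nat) (w : 'I_N -> R -> R) : Prop :=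
  exists c : R, forall i x, 0 <= x -> w i x = c.

End StarGraph.

(* Main.v *)
(** On each edge [w_i'' = 0] makes [w_i'] constant and then [w_i] affine, by the
    mean value theorem; a bounded affine function on [0, +oo[ is constant, and
    the constants agree because the [w_i] have the same value at the vertex. *)

Require Import Defs.
From HB Require Import structures.
From mathcomp Require Import all_boot all_order all_algebra.
From mathcomp Require Import all_classical all_reals all_analysis.
From mathcomp Require Import ring lra.

Import Order.TTheory GRing.Theory Num.Theory.
Import numFieldNormedType.Exports.

Local Open Scope classical_set_scope.
Local Open Scope ring_scope.

(** First-order expansion, free of division and of the puncture, so that continuity at the vertex
    and differentiability inside the edge both follow from it. *)
Lemma edge_derivable_approx (R : realType) (f : R -> R) (x e : R) :
  edge_derivable f x -> 0 < e ->
  \forall y \near x, 0 <= y ->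
    `|f y - f x - edge_derive f x * (y - x)| <= e * `|y - x|.
Proof.
move=> dfx e0.
have /cvgrPdist_le/(_ _ e0) : edge_quotient f x y @[y --> within `[0, +oo[ x^'] -->
  edge_derive f x by exact: dfx.
rewrite !near_withinE; apply: filterS => y yP y0.
(* The punctured limit says nothing at [y = x], but there both sides vanish. *)
have [->|yx] := eqVneq y x; first by rewrite !subrr mulr0 subr0 normr0 mulr0.
have yx0 : y - x != 0 by rewrite subr_eq0.
have -> : f y - f x - edge_derive f x * (y - x) =
    - ((edge_derive f x - edge_quotient f x y) * (y - x)).
  by rewrite /edge_quotient; field.
rewrite normrN normrM ler_wpM2r//; apply: yP => //=.
by rewrite in_itv/= y0.
Qed.

(** The expansion with error factor 1 bounds [|f y - f x|] by [(1 + |edge_derive f x|) * |y - x|]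
    near [x], including at the endpoint 0. *)
Lemma edge_derivable_within_continuous (R : realType) (f : R -> R) (b : R) :
  (forall x, 0 <= x -> edge_derivable f x) ->
  {within `[0, b], continuous f}.
Proof.
move=> df; apply/subspace_continuousP => x /=; rewrite in_itv/= => /andP[x0 _].
apply/cvgrPdist_le => e e0; rewrite near_withinE.
have k0 : 0 < 1 + `|edge_derive f x| by rewrite ltr_pwDl.
have d0 : 0 < e / (1 + `|edge_derive f x|) by rewrite divr_gt0.
near=> y => /=; rewrite in_itv/= => /andP[y0 _].
have H : `|f y - f x - edge_derive f x * (y - x)| <= 1 * `|y - x|.
  by move: y0; near: y; apply: edge_derivable_approx (df _ x0) ltr01.
have yx : `|x - y| <= e / (1 + `|edge_derive f x|).
  by near: y; exact: cvgr_dist_le.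
rewrite distrC -[f y - f x](subrK (edge_derive f x * (y - x))).
apply: (le_trans (ler_normD _ _)); apply: (le_trans (lerD H (lexx _))).
by rewrite normrM -mulrDl mulrC distrC -ler_pdivlMr.
Unshelve. all: by end_near. Qed.

(** A point [x > 0] has a neighbourhood inside the half-line, so the restriction to [[0, +oo[] is
    harmless there. *)
Lemma edge_derivable_is_derive (R : realType) (f : R -> R) (x : R) :
  0 < x -> edge_derivable f x -> is_derive x 1 f (edge_derive f x).
Proof.
move=> x0 dfx.
have L : h^-1 *: (f (h *: 1 + x) - f x) @[h --> 0^'] --> edge_derive f x.
  apply/cvgrPdist_le => e e0.
  (* The substitution [y = h + x] carries properties near [x] to properties of [h] near 0. *)
  have cx : h *: (1 : R) + x @[h --> (0 : R)] --> x.
    rewrite -[X in _ --> X]add0r -[X in _ --> X + _](scale0r (1 : R)).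
    by apply: cvgD; [apply: cvgZr_tmp; exact: cvg_id|exact: cvg_cst].
  have H := cx _ (edge_derivable_approx _ _ _ _ dfx e0).
  have P := cx _ (lt_nbhsr x0).
  near=> h.
  have h0 : h != 0 by near: h; exact: nbhs_dnbhs_neq.
  have hx : 0 < h *: (1 : R) + x by near: h; apply: nbhs_dnbhs; exact: P.
  have : `|f (h *: 1 + x) - f x - edge_derive f x * (h *: 1 + x - x)|
      <= e * `|h *: 1 + x - x|.
    by move: (ltW hx); near: h; apply: nbhs_dnbhs; exact: H.
  rewrite addrK !scaler1 => A.
  have -> : edge_derive f x - h^-1 *: (f (h + x) - f x) =
    - ((f (h + x) - f x - edge_derive f x * h) / h).
    by rewrite /GRing.scale/=; field.
  by rewrite normrN normf_div ler_pdivrMr ?normr_gt0.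
by apply: DeriveDef; [apply/cvg_ex; exists (edge_derive f x)|exact: cvg_lim L].
Unshelve. all: by end_near. Qed.

(** The mean value theorem on [[0, x]] needs derivatives only in the open interval and continuity up
    to 0. *)
Lemma edge_derive_cst_affine (R : realType) (f : R -> R) (c : R) :
  (forall x, 0 <= x -> edge_derivable f x) ->
  (forall x, 0 <= x -> edge_derive f x = c) ->
  forall x, 0 <= x -> f x = f 0 + c * x.
Proof.
move=> df fc x; rewrite le_eqVlt => /predU1P[<-|x0].
  by rewrite mulr0 addr0.
have [||y] := @MVT _ f (edge_derive f) 0 x x0.
- move=> y; rewrite in_itv/= => /andP[y0 _].
  exact: edge_derivable_is_derive y0 (df _ (ltW y0)).
- exact: edge_derivable_within_continuous.
rewrite in_itv/= => /andP[y0 _]; rewrite fc ?ltW// subr0 => <-.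
by rewrite addrC subrK.
Qed.

Lemma bounded_affine_slope0 (R : realFieldType) (a b M : R) :
  (forall x, 0 <= x -> `|a + b * x| <= M) -> b = 0.
Proof.
move=> H; apply/eqP/contraT => b0.
have M0 : 0 <= M by apply: le_trans (H 0 (lexx _)).
have b1 : 0 < `|b| by rewrite normr_gt0.
(* At this point the linear term has absolute value [M + |a| + 1], so the affine function is at
   least [M + 1] in absolute value. *)
have t0 : 0 <= (M + `|a| + 1) / `|b| by rewrite divr_ge0// !addr_ge0.
have := lerB_normD (b * ((M + `|a| + 1) / `|b|)) a.
rewrite (addrC _ a) normrM (ger0_norm t0) mulrCA divff ?gt_eqF// mulr1.
by have := H _ t0; lra.
Qed.

Theorem proposition3p2 (R : realType) (N : nat) (alpha : 'I_N -> R)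
    (alpha_gt0 : forall i : 'I_N, 0 < alpha i)
    (alpha_sum : \sum_(i < N) alpha i = 1)
    (w : 'I_N -> R -> R)
    (w_harmonic : harmonic_on_graph alpha w)
    (w_bounded : bounded_on_graph w) :
  constant_on_graph w.
Proof.
case: w_harmonic => dw d2w w0 _; case: w_bounded => M wM.
have w_cst i x : 0 <= x -> w i x = w i 0.
  have dwc y : 0 <= y -> edge_derive (w i) y = edge_derive (w i) 0.
    (* The affine lemma serves first for the derivative, with slope 0, and then for [w i] itself. *)
    move=> y0; rewrite (edge_derive_cst_affine _ (edge_derive (w i)) 0)//.
    - by rewrite mul0r addr0.
    - by move=> z /(dw i)[].
    - exact: d2w.
  have wE := edge_derive_cst_affine _ _ _ (fun z z0 => proj1 (dw i z z0)) dwc.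
  have b0 : edge_derive (w i) 0 = 0.
    apply: (@bounded_affine_slope0 _ (w i 0) _ M) => y y0.
    by rewrite -wE// wM.
  by move=> x0; rewrite wE// b0 mul0r addr0.
(* With no edge any constant works; otherwise the value on edge [ord0] at the vertex is shared by
   all edges. *)
case: N alpha alpha_gt0 alpha_sum w dw d2w w0 wM w_cst
    => [|n] alpha _ _ w _ _ w0 _ w_cst; first by exists 0 => -[].
by exists (w ord0 0) => i x x0; rewrite w_cst.
Qed.
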